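(* Let $G$ be an infinite group with identity $e$. Let $A$ be a subset of $G$ and let $X$ be a countable subset of $\Delta(A)$ such that $X = X^{-1}$ and $e \in X$. Then there exists a subset $Y$ of $A$ such that $\Delta(Y) = X$.
   Context: For a subset $A$ of an infinite group $G$, $\Delta(A) = \{g \in G : |gA \cap A| = \infty\}$, where $gA = \{ga : a \in A\}$. Also $X^{-1} = \{x^{-1} : x \in X\}$. *)

(* Defs.v *)
From mathcomp Require Import all_boot.
From mathcomp Require Import boolp classical_sets functions cardinality.

Set Implicit Arguments.
Unset Strict Implicit.
Unset Printing Implicit Defensive.

Local Open Scope group_scope.
Local Open Scope classical_set_scope.

(* [groupType] is the possibly infinite, possibly noncommutative group
   structure; the [choiceType] it contains is no restriction classically
   ([gen_eqMixin], [gen_choiceMixin] in [boolp]). *)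

Definition ltranslate (G : groupType) (g : G) (A : set G) : set G :=
  [set g * a | a in A].

Definition setinv (G : groupType) (X : set G) : set G := [set x^-1 | x in X].

(* The combinatorial derivation of [A]. *)
Definition Delta (G : groupType) (A : set G) : set G :=
  [set g | infinite_set (ltranslate g A `&` A)].

(* Main.v *)
Require Import Defs.
From mathcomp Require Import all_boot.
From mathcomp Require Import boolp classical_sets functions cardinality.

Set Implicit Arguments.
Unset Strict Implicit.
Unset Printing Implicit Defensive.

Local Open Scope group_scope.
Local Open Scope classical_set_scope.

(** An element [g] lies in [Delta A] exactly when infinitely many [a] satisfy
    both [a \in A] and [g * a \in A].  So [Y] is built as an increasing union
    of finite lists: at stage [n] a pair [a], [x n * a] of elements of [A] is
    added, where [x] enumerates [X] and takes every value infinitely often.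
    This puts every element of [X] in [Delta Y], provided that the elements
    [a] are pairwise distinct.

    Nothing else gets in because both new elements avoid the finite set of
    products [u * v^-1 * w] with [u], [v], [w] already in the list
    ([exists_shifted_pair_notin]).  Let [g] be a quotient of two elements of
    the current list.  If [g] is also a quotient involving a new element, then
    either the other element is old, and the new one is a product
    [u * v^-1 * w], or both are new, and [g] is one of [1], [x n],
    [(x n)^-1], hence in [X], which contains [1] and is closed under inverses.
    Therefore a quotient [g] outside [X] that is realised inside some finite
    list is realised by no further pair ([quotient_pair_old]), and [g] is not
    in [Delta Y]. *)

Lemma infinite_set_notin (T : eqType) (S : set T) (s : seq T) :
  infinite_set S -> exists2 b, S b & b \notin s.
Proof.
move=> Sinf; apply: contrapT => nex; apply: Sinf.
apply: (sub_finite_set _ (finite_seq s)) => b Sb /=.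
by apply/negPn/negP => bs; apply: nex; exists b.
Qed.

(** A countable set can be listed with infinite repetition: run through
    [nat * nat] and forget the second component. *)
Lemma countable_enum_repeat (T : Type) (X : set T) :
    countable X -> X !=set0 ->
  exists x : nat -> T, (forall n, X (x n)) /\
    forall t, X t -> exists2 r : nat -> nat, injective r & forall j, x (r j) = t.
Proof.
move=> Xcount [t0 Xt0].
case/countable_injP: Xcount => f finj.
have [|e eP] := @choice _ _
    (fun n t' => X t' /\ forall t, X t -> f t = n -> t' = t).
  move=> n; have [[t [Xt ftn]]|nex] := pselect (exists t, X t /\ f t = n).
    exists t; split=> // t' Xt' ft'n; apply: finj; rewrite ?inE //.
    by rewrite ftn.
  by exists t0; split=> // t Xt ftn; case: nex; exists t.
pose dec n : nat * nat := odflt (0, 0) (unpickle n).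
exists (fun n => e (dec n).1); split=> [n|t Xt]; first by case: (eP (dec n).1).
exists (fun j => pickle (f t, j)) => [i j /(pcan_inj pickleK)[]//|j].
by rewrite /dec pickleK /=; case: (eP (f t)) => _; apply.
Qed.

Section Quotients.
Variable G : groupType.
Implicit Types (A X : set G) (s : seq G) (g a u v w y : G).

Definition quotient_products s : seq G :=
  [seq p.1 * p.2^-1 * w | p <- [seq (u, v) | u <- s, v <- s], w <- s].

Lemma mem_quotient_products s u v w :
  u \in s -> v \in s -> w \in s -> u * v^-1 * w \in quotient_products s.
Proof.
move=> us vs ws; apply/allpairsP; exists ((u, v), w); split=> //=.
by apply/allpairsP; exists (u, v).
Qed.

(** Avoiding the products therefore also keeps the chosen elements distinct. *)
Lemma sub_quotient_products s : {subset s <= quotient_products s}.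
Proof.
by move=> u us; have := mem_quotient_products us us us; rewrite mulgVK.
Qed.

(** One finite exclusion serves for both elements: if [g * a] avoids [s] and
    its translate by [g], then [a] avoids [s]. *)
Lemma exists_shifted_pair_notin A g s : Delta A g ->
  exists a, [/\ A a, A (g * a), a \notin s & g * a \notin s].
Proof.
move=> /(infinite_set_notin (s ++ [seq g * u | u <- s]))[_ [[a Aa <-] Aga]].
rewrite mem_cat negb_or => /andP[gas nas]; exists a; split=> //.
by apply: contra nas => /(map_f (fun u => g * u)).
Qed.

(** If exactly one of [y] and [h * y] is new, comparing with the old pair that
    also has quotient [h] expresses it as a product [u * v^-1 * w] of old
    elements; if both are new, [h] is [1], [g] or [g^-1]. *)
Lemma quotient_pair_old s g a h y y0 : let s' := [:: a, g * a & s] in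
    a \notin quotient_products s -> g * a \notin quotient_products s ->
    h <> 1 -> h <> g -> h <> g^-1 ->
    y0 \in s -> h * y0 \in s -> y \in s' -> h * y \in s' ->
  y \in s /\ h * y \in s.
Proof.
move=> /= na nga h1 hg hgV y0s hy0s.
have new_old b : b \notin quotient_products s -> y = b -> h * y \notin s.
  move=> nb yb; apply/negP => hys; case/negP: nb.
  have := mem_quotient_products y0s hy0s hys.
  by rewrite invgM !mulgA mulgV mul1g mulVg mul1g yb.
have old_new b : b \notin quotient_products s -> h * y = b -> y \notin s.
  move=> nb hyb; apply/negP => ys; case/negP: nb.
  have := mem_quotient_products hy0s y0s ys.
  by rewrite mulgK hyb.
rewrite !inE => /or3P[/eqP yE|/eqP yE|ys] /or3P[/eqP hyE|/eqP hyE|hys].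
- by case: h1; apply: (mulIg y); rewrite hyE mul1g.
- by case: hg; apply: (mulIg y); rewrite hyE yE.
- by have := new_old _ na yE; rewrite hys.
- by case: hgV; apply: (mulIg y); rewrite hyE yE mulKg.
- by case: h1; apply: (mulIg y); rewrite hyE mul1g.
- by have := new_old _ nga yE; rewrite hys.
- by have := old_new _ na hyE; rewrite ys.
- by have := old_new _ nga hyE; rewrite ys.
- by [].
Qed.

Section Stages.
Variables (x : nat -> G) (pick : G -> seq G -> G).

Fixpoint stage n : seq G :=
  if n is m.+1 then
    let a := pick (x m) (stage m) in [:: a, x m * a & stage m]
  else [::].

Definition added n := pick (x n) (stage n).

Lemma stage_mono m n : m <= n -> {subset stage m <= stage n}.
Proof.
move=> /subnKC <-; elim: (n - m) => [|k IHk] u; first by rewrite addn0.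
by move=> /IHk us; rewrite addnS /= !inE us !orbT.
Qed.

Hypothesis pick_fresh : forall n,
  added n \notin quotient_products (stage n) /\
  x n * added n \notin quotient_products (stage n).

Lemma added_inj : injective added.
Proof.
have lt_neq m n : m < n -> added m <> added n.
  move=> mn e; have [/negP[]] := pick_fresh n.
  rewrite -e; apply/sub_quotient_products/(stage_mono mn).
  exact: mem_head.
move=> m n e; case: (ltngtP m n) => // /lt_neq; first by move/(_ e).
by move/(_ (esym e)).
Qed.

Definition stage_limit : set G := [set u | exists n, u \in stage n].

Lemma stage_limit_pair g y : stage_limit y -> stage_limit (g * y) ->
  exists n, y \in stage n /\ g * y \in stage n.
Proof.
move=> [m ym] [n gyn]; exists (maxn m n); split.
  exact: stage_mono (leq_maxl m n) _ ym.
exact: stage_mono (leq_maxr m n) _ gyn.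
Qed.

(** Once [g] is realised as a quotient inside [stage m], no later stage
    realises it anew, so all the pairs with quotient [g] lie in the finite
    list [stage m]. *)
Lemma Delta_stage_limit_sub X : (forall n, X (x n)) -> X 1 ->
  (forall g, X g -> X g^-1) -> Delta stage_limit `<=` X.
Proof.
move=> Xx X1 XV g gD; apply: contrapT => nXg.
have [_ [[y0 Yy0 <-] Ygy0] _] := infinite_set_notin [::] gD.
have [m [y0m gy0m]] := stage_limit_pair Yy0 Ygy0.
have back y k : y \in stage (m + k) -> g * y \in stage (m + k) ->
    g * y \in stage m.
  elim: k => [|k IHk]; rewrite ?addn0 // addnS => yk gyk.
  have [na nga] := pick_fresh (m + k).
  have le_mk := stage_mono (leq_addr k m).
  have [] := quotient_pair_old na nga _ _ _ (le_mk _ y0m) (le_mk _ gy0m) yk gyk.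
  - by move=> gE; apply: nXg; rewrite gE.
  - by move=> gE; apply: nXg; rewrite gE.
  - by move=> gE; apply: nXg; rewrite gE; apply: XV.
  - exact: IHk.
apply: gD; apply: (sub_finite_set _ (finite_seq (stage m))).
move=> _ [[y Yy <-] Ygy] /=.
have [n [yn gyn]] := stage_limit_pair Yy Ygy.
have le_n := stage_mono (leq_addl m n).
exact: back (le_n _ yn) (le_n _ gyn).
Qed.

Lemma Delta_stage_limit_sup g (r : nat -> nat) :
  injective r -> (forall j, x (r j) = g) -> Delta stage_limit g.
Proof.
move=> rinj xr; apply/infiniteP.
have in_limit j : stage_limit (added (r j)) /\ stage_limit (g * added (r j)).
  by split; exists (r j).+1; rewrite -?(xr j) !inE eqxx ?orbT.
have f_inj : {in [set: nat] &, injective (fun j => g * added (r j))}.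
  by move=> i j _ _ /mulgI/added_inj/rinj.
have := inj_card_eq f_inj; rewrite card_eq_le => /andP[_ le_im].
apply: card_le_trans le_im _; apply: subset_card_le => _ [j _ <-].
by have [Ya Yga] := in_limit j; split=> //; exists (added (r j)).
Qed.

End Stages.
End Quotients.

Theorem theorem2 (G : groupType) (Ginf : infinite_set [set: G])
    (A X : set G) (XA : X `<=` Delta A) (Xcount : countable X)
    (Xinv : X = setinv X) (X1 : X 1) :
  exists Y : set G, Y `<=` A /\ Delta Y = X.
Proof.
have [x [Xx xrep]] := countable_enum_repeat Xcount (ex_intro _ 1 X1).
have [|pick pickP] := @choice _ _ (fun (p : G * seq G) a => X p.1 ->
    [/\ A a, A (p.1 * a), a \notin quotient_products p.2 &
        p.1 * a \notin quotient_products p.2]).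
  (* Outside [X] no choice is required; [1] is a default value. *)
  move=> [g s] /=; have [Xg|nXg] := pselect (X g); last by exists 1.
  by have [a aP] := exists_shifted_pair_notin (quotient_products s) (XA _ Xg);
    exists a.
pose p g s := pick (g, s).
have pP n := pickP (x n, stage x p n) (Xx n).
have fresh n : added x p n \notin quotient_products (stage x p n) /\
    x n * added x p n \notin quotient_products (stage x p n).
  by case: (pP n).
exists (stage_limit x p); split.
  move=> y [n]; elim: n => [//|n IHn] /=; have [Aa Axa _ _] := pP n.
  by rewrite !inE => /or3P[/eqP->|/eqP->|].
apply/seteqP; split=> [|g /xrep[r rinj xr]].
  apply: Delta_stage_limit_sub => // g Xg.
  by rewrite Xinv; exists g.
exact: Delta_stage_limit_sup xr.
Qed.
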